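(* Let $m,n\ge1$ and $l,p\ge0$ be integers. For a partition $\lambda$, write $\lambda'=(\lambda'_1,\lambda'_2,\dots)$ for its conjugate, set $\lambda'_0=n$, and let $e_i=\lambda'_i-\lambda'_{i+1}$ for $i\ge0$; in particular $e_0+e_1+\cdots=n$. Then $$\sum_{|\lambda|=m-1,\ \ell(\lambda)\le n} q^{(p+1)(m-1)+2n(\lambda)}{n\brack e_0,e_1,\ldots}_q\sum_{i\ge0}q^{(1-p)i-2\sum_{k=1}^{i}\lambda'_k}{i+p-l\brack p}_q[e_i]_q=[n]_q{n+m-2+p-l\brack n-1+p}_q .$$
   Context: For a partition $\lambda$, $|\lambda|$ denotes its weight, $\ell(\lambda)=\lambda'_1$ its length, and $n(\lambda)=\sum_i\binom{\lambda'_i}{2}$. The $q$-shifted factorial is $(a;q)_k=(1-a)(1-aq)\cdots(1-aq^{k-1})$. The $q$-integer is $[N]_q=(1-q^N)/(1-q)$. The $q$-binomial coefficient is ${N\brack k}_q=\frac{(q;q)_N}{(q;q)_k(q;q)_{N-k}}$, taken to be $0$ unless $0\le k\le N$. The $q$-multinomial coefficient is ${N\brack e_0,e_1,\ldots,e_s}_q=\frac{(q;q)_N}{(q;q)_{e_0}\cdots(q;q)_{e_s}}$ when $e_0+\cdots+e_s=N$. *)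

(* Defs.v *)
From HB Require Import structures.
From mathcomp Require Import all_boot all_order all_algebra.
From mathcomp Require Import boolp classical_sets cardinality fsbigop.

Set Implicit Arguments.
Unset Strict Implicit.
Unset Printing Implicit Defensive.

Import GRing.Theory.
Local Open Scope ring_scope.

Section QAnalogues.
Variables (F : fieldType) (q : F).

Definition qpochhammer (a : F) (k : nat) : F := \prod_(i < k) (1 - a * q ^+ i).

Definition qint (N : nat) : F := (1 - q ^+ N) / (1 - q).

(* The arguments are integers: truncated subtraction in an upper argument such
   as i + p - l would turn binomials that must vanish into nonzero ones. *)
Definition qbinomial (N k : int) : F :=
  if (0 <= k) && (k <= N) then
    qpochhammer q `|N|%N /
      (qpochhammer q `|k|%N * qpochhammer q `|N - k|%N)
  else 0.

(* Only meaningful when the entries of es sum to N; see sumn_part_mults. *)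
Definition qmultinomial (N : nat) (es : seq nat) : F :=
  qpochhammer q N / \prod_(e <- es) qpochhammer q e.

End QAnalogues.

(* A partition is the weakly decreasing sequence of its positive parts, so its
   weight is sumn la and its length is size la. *)
Definition is_partition (la : seq nat) : bool := sorted geq la && (0%N \notin la).

Definition largest_part (la : seq nat) : nat := head 0%N la.

(* Item i (from 0) of the conjugate is lambda'_(i+1). *)
Definition conj_part (la : seq nat) : seq nat :=
  [seq count (fun x => (i < x)%N) la | i <- iota 0 (largest_part la)].

(* lambda'_i for every i >= 0, with the convention lambda'_0 = n. *)
Definition part_col (n : nat) (la : seq nat) (i : nat) : nat :=
  nth 0%N (n :: conj_part la) i.

Definition part_n (la : seq nat) : nat := \sum_(c <- conj_part la) 'C(c, 2).

(* e_i = lambda'_i - lambda'_(i+1); no truncation occurs when la is a partition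
   with size la <= n, see part_col_decr. *)
Definition part_mult (n : nat) (la : seq nat) (i : nat) : nat :=
  (part_col n la i - part_col n la i.+1)%N.

(* e_0, ..., e_s with s = lambda_1; all later e_i vanish. *)
Definition part_mults (n : nat) (la : seq nat) : seq nat :=
  [seq part_mult n la i | i <- iota 0 (largest_part la).+1].

Definition partitions_of (k n : nat) : set (seq nat) :=
  [set la | [/\ is_partition la, sumn la = k & (size la <= n)%N]]%classic.

Lemma size_conj_part la : size (conj_part la) = largest_part la.
Proof. by rewrite size_map size_iota. Qed.

Lemma part_col_large n la i : (largest_part la < i)%N -> part_col n la i = 0%N.
Proof. by move=> lt_i; rewrite /part_col nth_default //= size_conj_part. Qed.

Lemma part_mult_large n la i : (largest_part la < i)%N -> part_mult n la i = 0%N.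
Proof. by move=> lt_i; rewrite /part_mult (part_col_large _ lt_i). Qed.

Lemma part_col_decr n la i :
  (size la <= n)%N -> (part_col n la i.+1 <= part_col n la i)%N.
Proof.
move=> le_n; case: (ltnP i (largest_part la)) => [lt_i|le_i]; last first.
  by rewrite part_col_large.
rewrite /part_col [nth _ _ i.+1]/= (nth_map 0%N) ?size_iota // nth_iota // add0n.
case: i lt_i => [|i] lt_i /=; first exact: leq_trans (count_size _ _) le_n.
have lt_i' := ltnW lt_i.
rewrite (nth_map 0%N) ?size_iota // nth_iota // add0n.
by apply: sub_count => x /=; apply: ltnW.
Qed.

Lemma sumn_part_mults n la : (size la <= n)%N -> sumn (part_mults n la) = n.
Proof.
move=> le_n; rewrite sumnE big_map -[iota _ _]/(index_iota 0 (largest_part la).+1).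
have H k : (\sum_(0 <= i < k) part_mult n la i + part_col n la k = n)%N.
  elim: k => [|k IHk]; first by rewrite big_nil.
  by rewrite big_nat_recr //= -addnA subnK // part_col_decr.
by rewrite -[RHS](H (largest_part la).+1) part_col_large ?addn0.
Qed.

Lemma finite_partitions_of k n : finite_set (partitions_of k n).
Proof.
suff H s : finite_set
    [set la : seq nat | (size la <= s)%N /\ all (fun x => (x < k.+1)%N) la]%classic.
  apply: sub_finite_set (H n) => la [_ <- le_n] /=; split=> //.
  by elim: la {le_n} => //= x la IHla; rewrite ltnS leq_addr /=;
     apply: sub_all IHla => y; rewrite !ltnS => /leq_trans; apply; apply: leq_addl.
elim: s => [|s IHs].
  by apply: sub_finite_set (finite_set1 [::]) => -[|x la] [].
apply: (@sub_finite_set _ _ ([set [::]] `|` [set x :: la | x in `I_k.+1 & la in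
    [set la : seq nat | (size la <= s)%N /\ all (fun x => (x < k.+1)%N) la]])%classic).
  move=> [|x la] [/= le_s]; first by left.
  by case/andP=> lt_x all_la; right; exists x => //; exists la.
by rewrite finite_setU; split; [exact: finite_set1 | apply: finite_image2].
Qed.

(* Main.v *)
Require Import Defs.
From mathcomp Require Import all_boot all_order all_algebra.
From mathcomp Require Import boolp classical_sets cardinality fsbigop.
From mathcomp Require Import functions zify ring.

(* Since [n; e_0, e_1, ...] [e_i] = [n] [n-1; ..., e_i - 1, ...], the weight
   [e_i] marks one part equal to i among the n parts of lambda (zeros included).
   Removing it lowers the first i columns by one, and 2 n(lambda) drops by
   2 (lambda'_1 + ... + lambda'_i) - 2 i. Hence, if P(n, M) denotes the sum of
   q^(2 n(mu)) [n; e_0(mu), ...] over partitions mu of M with at most n parts,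
   the left-hand side is [n] times the sum over i of
   q^((p+1)(m-1-i)) [i+p-l; p] P(n-1, m-1-i). Splitting off the first column
   and the q-Vandermonde identity give P(n, M) = [n+M-1; M], and what remains is
   the coefficientwise form of
   1/(z;q)_(p+1) * 1/(z q^(p+1);q)_(n-1) = 1/(z;q)_(n+p). *)

Set Implicit Arguments.
Unset Strict Implicit.
Unset Printing Implicit Defensive.

Import Order.TTheory GRing.Theory Num.Theory.
Local Open Scope ring_scope.

Lemma qbinomial_small (F : fieldType) (q : F) (N k : int) :
  N < k -> qbinomial q N k = 0.
Proof. by move=> ltNk; rewrite /qbinomial [k <= N]leNgt ltNk andbF. Qed.

(** * The q-Pascal, q-Vandermonde, convolution and absorption identities *)

Section QBinomial.
Variables (F : fieldType) (q : F).
Hypothesis q_not_root1 : forall k : nat, (0 < k)%N -> q ^+ k != 1.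

Local Notation qp := (qpochhammer q q).
Local Notation qbin N k := (qbinomial q (Posz N) (Posz k)).

Lemma qpoch0 : qp 0 = 1. Proof. by rewrite /qpochhammer big_ord0. Qed.

Lemma qpochS k : qp k.+1 = qp k * (1 - q ^+ k.+1).
Proof. by rewrite /qpochhammer big_ord_recr /= -exprS. Qed.

Lemma qpow_neq1 k : 1 - q ^+ k.+1 != 0.
Proof. by rewrite subr_eq0 eq_sym q_not_root1. Qed.

Lemma qpoch_neq0 k : qp k != 0.
Proof.
by elim: k => [|k IHk]; rewrite ?qpoch0 ?oner_neq0 // qpochS mulf_neq0 ?qpow_neq1.
Qed.

Lemma qbinD k j : qbin (k + j) k = qp (k + j) / (qp k * qp j).
Proof.
rewrite /qbinomial !lez_nat leq0n leq_addr /=.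
by have -> : `|(k + j)%:Z - k%:Z|%N = j by lia.
Qed.

Lemma qbin_small n k : (n < k)%N -> qbin n k = 0.
Proof. by move=> ltnk; rewrite /qbinomial !lez_nat leq0n leqNgt ltnk. Qed.

Lemma qbin0 n : qbin n 0 = 1.
Proof. by rewrite -[n]add0n qbinD qpoch0 mul1r divff ?qpoch_neq0. Qed.

Lemma qbinn n : qbin n n = 1.
Proof.
by rewrite -[X in qbin X _]addn0 qbinD qpoch0 addn0 mulr1 divff ?qpoch_neq0.
Qed.

Lemma qbinS n k : qbin n.+1 k.+1 = qbin n k + q ^+ k.+1 * qbin n k.+1.
Proof.
have [|/ltnW lekn|->] := ltngtP n k; last first.
- by rewrite !qbinn qbin_small // mulr0 addr0.
- case: (ltngtP k n) lekn => // [ltkn _|-> _]; last first.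
    by rewrite !qbinn qbin_small // mulr0 addr0.
  have [j ->] : exists j, n = (k.+1 + j)%N by exists (n - k.+1)%N; lia.
  rewrite -addnS !qbinD [X in qbin X k]addSnnS qbinD !addSn !addnS !qpochS.
  have -> : (k + j).+2 = (k.+1 + j.+1)%N by lia.
  by rewrite exprD; field; rewrite !qpoch_neq0 !qpow_neq1.
- by move=> ltnk; rewrite !qbin_small ?mulr0 ?addr0 //; lia.
Qed.

(** The q-Pascal rule with the power of q on the other term. Writing the upper index as k + j gives
    the exponent j without a truncated subtraction. *)
Lemma qbinS' k j :
  qbin (k + j).+1 k.+1 = qbin (k + j) k.+1 + q ^+ j * qbin (k + j) k.
Proof.
case: j => [|j]; first by rewrite addn0 !qbinn qbin_small // mulr1 add0r.
rewrite -addSn -[X in _ = qbin X _ + _]addSnnS !qbinD !addSn !addnS !qpochS.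
have -> : (k + j).+2 = (k.+1 + j.+1)%N by lia.
by rewrite exprD; field; rewrite !qpoch_neq0 !qpow_neq1.
Qed.

Lemma qbin_sym k j : qbin (k + j) k = qbin (k + j) j.
Proof. by rewrite qbinD addnC qbinD [qp k * _]mulrC. Qed.

(** Induction on A with n and b free. The q-Pascal rule on [A+1; j] splits the sum in two; regrouped
    by their factor [A; i], the halves merge by the q-Pascal rule on [n+1; i+b+1], leaving the
    instance (A, n+1, b+1). *)
Lemma qVandermonde A n b :
  \sum_(j < A.+1) qbin A j * qbin n (j + b) * q ^+ (j * (j + b))
  = qbin (n + A) (A + b).
Proof.
elim: A n b => [|A IHA] n b.
  by rewrite big_ord1 qbin0 mul0n expr0 mulr1 mul1r addn0.
rewrite big_ord_recl /= qbin0 mul0n expr0 mulr1 mul1r add0n.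
under eq_bigr do rewrite /bump add1n qbinS !mulrDl.
rewrite big_split /=.
have -> : qbin n b + (\sum_(i < A.+1) qbin A i * qbin n (i.+1 + b)
                        * q ^+ (i.+1 * (i.+1 + b))
    + \sum_(i < A.+1) q ^+ i.+1 * qbin A i.+1 * qbin n (i.+1 + b)
                        * q ^+ (i.+1 * (i.+1 + b)))
  = \sum_(i < A.+1) qbin A i * qbin n (i.+1 + b) * q ^+ (i.+1 * (i.+1 + b))
    + \sum_(i < A.+2) q ^+ i * qbin A i * qbin n (i + b) * q ^+ (i * (i + b)).
  rewrite addrCA; congr (_ + _); rewrite [RHS]big_ord_recl /=.
  by rewrite qbin0 mul0n expr0 !mulr1 mul1r.
rewrite [X in _ + X]big_ord_recr /= qbin_small // mulr0 !mul0r addr0.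
rewrite -big_split /=.
have -> : (A.+1 + b = A + b.+1)%N by lia.
rewrite addnS -addSn -IHA; apply: eq_bigr => i _.
rewrite addnS qbinS -addSn.
have -> : (i.+1 * (i.+1 + b) = i * (i + b).+1 + (i + b).+1)%N by lia.
have -> : (i * (i + b).+1 = i * (i + b) + i)%N by lia.
by rewrite !exprD addSn; ring.
Qed.

(** The coefficient of z^K in 1/(z;q)_(p+1) * 1/(z q^(p+1);q)_N = 1/(z;q)_(N+p+1). The induction on
    N and K applies one q-Pascal rule to the right-hand side and the other to the last binomial of
    each summand. *)
Lemma qbin_conv p N K :
  \sum_(j < K.+1) qbin (K - j + p) p * q ^+ (p.+1 * j) * qbin (N + j).-1 j
  = qbin (N + p + K) (N + p).
Proof.
elim: N K => [|N IHN] K.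
  (* For N = 0 only j = 0 survives: there the truncated predecessor gives [0; 0] = 1, and for j > 0
     the factor is [j-1; j] = 0. *)
  rewrite big_ord_recl big1 => [|i _].
    by rewrite qbin0 muln0 mulr1 mulr1 addr0 subn0 add0n addnC.
  by rewrite /bump /= [X in _ * X]qbin_small ?mulr0 //; lia.
elim: K => [|K IHK].
  by rewrite big_ord1 addn0 muln0 mulr1 qbin0 mulr1 add0n !qbinn.
have -> : (N.+1 + p + K.+1 = (N + p + K.+1).+1)%N by lia.
rewrite addSn qbinS -IHN.
have -> : (N + p + K.+1 = N.+1 + p + K)%N by lia.
rewrite -addSn -IHK big_ord_recl [in RHS]big_ord_recl /= -addrA; congr (_ + _).
  by rewrite !qbin0.
rewrite mulr_sumr -big_split; apply: eq_bigr => i _ /=.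
rewrite /bump !add1n subSS [(N + i.+1)%N]addnC addSn qbinS' [(i + N)%N]addnC /=.
by rewrite mulnS exprD addSn -addnS exprD; ring.
Qed.

Lemma qint0 : qint q 0 = 0. Proof. by rewrite /qint subrr mul0r. Qed.

Lemma qbin_absorb n k : qbin n k.+1 * qint q k.+1 = qint q n * qbin n.-1 k.
Proof.
case: n => [|n]; first by rewrite qbin_small // qint0 !mul0r.
have [ltnk|lekn] := ltnP n k; first by rewrite !qbin_small ?mulr0 ?mul0r.
rewrite /= -(subnKC lekn) -addSn !qbinD /qint addSn !qpochS.
have := q_not_root1 (ltn0Sn 0); rewrite expr1 => q_neq1.
by field; rewrite !qpoch_neq0 // !qpow_neq1 // subr_eq0 eq_sym q_neq1.
Qed.

Lemma qbin_absorb_compl n k : (k <= n)%N ->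
  qbin n k * qint q (n - k) = qint q n * qbin n.-1 k.
Proof.
move=> lekn; rewrite -(subnKC lekn) qbin_sym // addKn; case: (n - k)%N => [|j].
  rewrite addn0 qint0 mulr0; case: k {lekn} => [|k]; first by rewrite qint0 mul0r.
  by rewrite qbin_small ?mulr0.
by rewrite qbin_absorb addnS /= qbin_sym.
Qed.

End QBinomial.

(** * Adding and deleting the first column of a Young diagram *)

(* Prepends the column k to the Young diagram of mu; meant for size mu <= k. *)
Definition add_col (k : nat) (mu : seq nat) : seq nat :=
  [seq x.+1 | x <- mu ++ nseq (k - size mu) 0%N].

Definition del_col (la : seq nat) : seq nat :=
  [seq x <- [seq y.-1 | y <- la] | (0 < x)%N].

Lemma size_add_col k mu : (size mu <= k)%N -> size (add_col k mu) = k.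
Proof. by move=> le_k; rewrite size_map size_cat size_nseq subnKC. Qed.

Lemma sumn_map_succn s : sumn (map succn s) = (size s + sumn s)%N.
Proof. by elim: s => //= x s ->; lia. Qed.

Lemma sumn_add_col k mu :
  (size mu <= k)%N -> sumn (add_col k mu) = (k + sumn mu)%N.
Proof.
move=> le_k; rewrite sumn_map_succn size_cat size_nseq subnKC // sumn_cat.
by rewrite sumn_nseq mul0n addn0.
Qed.

Lemma add_colK k mu : 0%N \notin mu -> del_col (add_col k mu) = mu.
Proof.
move=> mu_pos; rewrite /del_col /add_col -map_comp map_id filter_cat.
rewrite filter_nseq /= cats0.
by apply/all_filterP/allP => x; case: x => // /(negP mu_pos).
Qed.

(** In a weakly decreasing sequence the zeros form the tail, so filtering them out and padding back
    restores it. *)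
Lemma filter_pos_sorted s :
  sorted geq s ->
  [seq x <- s | (0 < x)%N]
    ++ nseq (size s - size [seq x <- s | (0 < x)%N]) 0%N = s.
Proof.
elim: s => //= x s IHs; rewrite path_sortedE; last first.
  by move=> ? ? ? /= /[swap]; apply: leq_trans.
case/andP=> x_max /IHs; case: x x_max => [|x] /= x_max IH.
  2: by rewrite subSS IH.
suff -> : s = nseq (size s) 0%N by rewrite filter_nseq /= size_nseq.
by apply/all_pred1P; apply: sub_all x_max => y /=; rewrite leqn0.
Qed.

Lemma del_colK la : is_partition la -> add_col (size la) (del_col la) = la.
Proof.
case/andP=> la_sorted la_pos; rewrite /add_col /del_col.
rewrite -[X in nseq (X - _)](size_map predn) filter_pos_sorted; last first.
  rewrite sorted_map; apply: sub_sorted la_sorted => x y /=; lia.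
rewrite -map_comp -[RHS]map_id; apply/eq_in_map => -[|x] //=.
by move/(negP la_pos).
Qed.

Lemma is_partition_add_col k mu : is_partition mu -> is_partition (add_col k mu).
Proof.
case/andP=> mu_sorted _; apply/andP; split; last by apply/mapP => -[].
rewrite sorted_map; move: mu_sorted.
have tr : transitive geq by move=> ? ? ? /= /[swap]; apply: leq_trans.
have tr' : transitive (relpre succn geq).
  by move=> ? ? ? /= /[swap]; apply: leq_trans.
(* In pairwise form the concatenation splits into [mu] against the padding, [mu] itself, and the
   padding itself. *)
rewrite !sorted_pairwise // pairwise_cat => mu_pw; apply/and3P; split.
- by apply/allrelP => x y _; rewrite mem_nseq => /andP[_ /eqP ->].
- exact: sub_pairwise mu_pw.
- elim: (k - _)%N => //= j ->; rewrite andbT; apply/allP => x.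
  by rewrite mem_nseq => /andP[_ /eqP ->].
Qed.

Lemma is_partition_del_col la : is_partition la -> is_partition (del_col la).
Proof.
case/andP=> la_sorted _; apply/andP; split; last by rewrite mem_filter.
apply: sorted_filter; first by move=> ? ? ? /= /[swap]; apply: leq_trans.
by rewrite sorted_map; apply: sub_sorted la_sorted => x y /=; lia.
Qed.

Lemma size_del_col la : (size (del_col la) <= size la)%N.
Proof. by rewrite size_filter (leq_trans (count_size _ _)) // size_map. Qed.

Lemma size_le_sumn la : 0%N \notin la -> (size la <= sumn la)%N.
Proof.
by elim: la => //= x la IH; rewrite inE negb_or; case/andP=> ? /IH; lia.
Qed.

Lemma add_col_bij M n k : (k <= M)%N -> (k <= n)%N ->
  set_bij (partitions_of (M - k) k)
    (partitions_of M n `&` [set la | size la = k])%classic (add_col k).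
Proof.
move=> leM len; split.
- move=> mu /= [mu_part mu_sum le_k].
  by rewrite size_add_col //; split=> //; split;
    rewrite ?is_partition_add_col ?size_add_col ?sumn_add_col // mu_sum subnKC.
- move=> mu nu /set_mem[/andP[_ mu_pos] _ _] /set_mem[/andP[_ nu_pos] _ _] eq_col.
  by rewrite -(add_colK k mu_pos) eq_col add_colK.
- move=> la [[la_part la_sum _] /= size_la].
  exists (del_col la); last by rewrite -size_la del_colK.
  have size_del := size_del_col la; rewrite size_la in size_del.
  split=> //; first exact: is_partition_del_col.
  have := del_colK la_part; rewrite size_la => /(congr1 sumn).
  by rewrite sumn_add_col // la_sum => <-; rewrite addKn.
Qed.

(** Groups the partitions by their length k, which is at most M because parts are positive, and then
    strips the first column. The proof inserts the indicator of length k so that the two sums can be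
    exchanged. *)
Lemma fsum_partitions_col (V : nmodType) (M n : nat) (f : seq nat -> V) :
  \sum_(la \in partitions_of M n) f la
  = \sum_(k < M.+1 | (k <= n)%N)
      \sum_(mu \in partitions_of (M - k) k) f (add_col k mu).
Proof.
transitivity (\sum_(la \in partitions_of M n)
   \sum_(k < M.+1 | (k <= n)%N)
      if la \in [set la | size la = k]%classic then f la else 0).
  apply: eq_fsbigr => la /set_mem[/andP[_ la_pos] la_sum size_la].
  have lt_M : (size la < M.+1)%N by rewrite ltnS -la_sum size_le_sumn.
  rewrite (bigD1 (Ordinal lt_M)) //= mem_set // big1 ?addr0 // => k /andP[_ ne_k].
  by case: ifP => // /set_mem /= eq_k; case/eqP: ne_k; apply/val_inj.
rewrite (fsbig_finite _ _ (finite_partitions_of M n)) /= exchange_big.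
apply: eq_bigr => k le_n; rewrite -(fsbig_finite _ _ (finite_partitions_of M n)).
rewrite -fsbig_mkcondr.
by rewrite (reindex_fsbig (add_col k) _ _ _ (add_col_bij _ le_n)) // -ltnS.
Qed.

Lemma conj_part_add_col k mu : (0 < k)%N -> (size mu <= k)%N ->
  conj_part (add_col k mu) = k :: conj_part mu.
Proof.
move=> k_gt0 le_k; rewrite /conj_part.
have -> : largest_part (add_col k mu) = (largest_part mu).+1.
  by case: mu le_k => //= _; rewrite /add_col subn0; case: k k_gt0.
rewrite /= -[iota 1 _]/(iota (1 + 0) _) iotaDl -map_comp; congr (_ :: _).
  rewrite -[RHS](size_add_col le_k); apply/eqP; rewrite -all_count.
  by apply/allP => x /mapP[y _ ->].
apply: eq_map => i /=; rewrite /add_col count_map count_cat count_nseq.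
by rewrite addn0.
Qed.

(** The convention for column 0 makes this uniform in i: the new first column has height k, which is
    column 0 of [mu] under the bound k. *)
Lemma part_col_add_col n k mu i : (size mu <= k)%N ->
  part_col n (add_col k mu) i.+1 = part_col k mu i.
Proof.
case: k => [|k] le_k; last by rewrite /part_col conj_part_add_col.
case: mu le_k => // _; rewrite /part_col /conj_part /= nth_nil.
by case: i => //= i; rewrite nth_nil.
Qed.

Lemma part_n_add_col k mu :
  (size mu <= k)%N -> part_n (add_col k mu) = ('C(k, 2) + part_n mu)%N.
Proof.
case: k => [|k] le_k; last by rewrite /part_n conj_part_add_col // big_cons.
by case: mu le_k => // _; rewrite /add_col /= bin0n.
Qed.

Lemma part_mult_add_col0 n k mu : (size mu <= k)%N ->
  part_mult n (add_col k mu) 0 = (n - k)%N.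
Proof. by move=> le_k; rewrite /part_mult part_col_add_col. Qed.

Lemma part_mult_add_colS n k mu i : (size mu <= k)%N ->
  part_mult n (add_col k mu) i.+1 = part_mult k mu i.
Proof. by move=> le_k; rewrite /part_mult !part_col_add_col. Qed.

Lemma part_mults_add_col n k mu : (0 < k)%N -> (size mu <= k)%N ->
  part_mults n (add_col k mu) = (n - k)%N :: part_mults k mu.
Proof.
move=> k_gt0 le_k; rewrite /part_mults -!size_conj_part conj_part_add_col //.
rewrite -[iota 0 (size (_ :: _)).+1]
  /(0%N :: iota (1 + 0) (size (conj_part mu)).+1).
rewrite iotaDl map_cons part_mult_add_col0 // -map_comp; congr (_ :: _).
by apply: eq_map => i; exact: part_mult_add_colS.
Qed.

Lemma largest_part_le_sumn la : (largest_part la <= sumn la)%N.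
Proof. by case: la => //= x la; apply: leq_addr. Qed.

(** * Weighted sums over partitions *)

Section PartitionSums.
Variables (F : fieldType) (q : F).
Hypothesis q_neq0 : q != 0.
Hypothesis q_not_root1 : forall k : nat, (0 < k)%N -> q ^+ k != 1.

Local Notation qbin N k := (qbinomial q (Posz N) (Posz k)).

Definition part_weight n la : F :=
  q ^+ (2 * part_n la) * qmultinomial q n (part_mults n la).

Definition part_sum n M : F := \sum_(la \in partitions_of M n) part_weight n la.

Lemma qmultinomial_add_col n k mu : (k <= n)%N -> (size mu <= k)%N ->
  qmultinomial q n (part_mults n (add_col k mu))
  = qbin n k * qmultinomial q k (part_mults k mu).
Proof.
move=> le_n le_k; rewrite /qmultinomial; case: k le_n le_k => [|k] le_n le_k.
  (* For k = 0 no column is added and [part_mults_add_col] does not apply; both multinomials equal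
     1. *)
  case: mu le_k => // _; rewrite /part_mults /= !big_seq1.
  rewrite /part_mult /part_col /= !subn0.
  by rewrite !divff ?qpoch_neq0 // qbin0 // mulr1.
rewrite part_mults_add_col // big_cons -(subnKC le_n) addKn qbinD // !invfM.
rewrite !mulrA; congr (_ / _).
by field; rewrite !qpoch_neq0.
Qed.

Lemma part_weight_add_col n k mu : (k <= n)%N -> (size mu <= k)%N ->
  part_weight n (add_col k mu) = qbin n k * q ^+ (k * k.-1) * part_weight k mu.
Proof.
move=> le_n le_k; rewrite /part_weight qmultinomial_add_col // part_n_add_col //.
rewrite mulnDr exprD; have -> : (2 * 'C(k, 2) = k * k.-1)%N.
  rewrite bin2 mul2n even_halfK //; case: k {le_n le_k} => //= k.
  by rewrite oddM /= andNb.
by ring.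
Qed.

Lemma part_sum_rec n M : part_sum n M
  = \sum_(k < M.+1) qbin n k * q ^+ (k * k.-1) * part_sum k (M - k).
Proof.
rewrite /part_sum fsum_partitions_col big_mkcond; apply: eq_bigr => k _.
case: ifPn => [le_n|]; last by rewrite -ltnNge => /qbin_small ->; rewrite !mul0r.
rewrite mulr_fsumr; apply: eq_fsbigr => mu /set_mem[_ _ le_k].
exact: part_weight_add_col.
Qed.

Lemma partitions_of0 n : partitions_of 0 n = [set [::]]%classic.
Proof.
apply/seteqP; split=> la /=; last by move=> ->.
case=> /andP[_ /size_le_sumn le_sum] eq0 _; apply/size0nil/eqP.
by rewrite -leqn0 -eq0.
Qed.

Lemma part_sumE n M : part_sum n M = qbin (n + M).-1 M.
Proof.
elim/ltn_ind: M n => -[|M] IHM n.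
  rewrite /part_sum partitions_of0 fsbig_set1 /part_weight /part_n /qmultinomial.
  rewrite /conj_part /= big_nil big_seq1 /part_mult subn0.
  by rewrite divff ?qpoch_neq0 // mul1r qbin0.
rewrite part_sum_rec big_ord_recl /=.
(* The term k = 0 is zero: a positive number has no partition without parts. *)
rewrite [part_sum 0 _]fsbig1 ?mulr0 ?add0r; last first.
  by move=> la [_ +]; rewrite leqn0 => + /nilP la_nil; rewrite la_nil.
(* With k = j + 1, the induction hypothesis gives P(j+1, M-j) = [M; M-j] = [M; j] and k(k-1) =
   j(j+1), so the sum is q-Vandermonde with A = M and b = 1. *)
rewrite addnS /= -(addn1 M) -qVandermonde //.
rewrite addn1; apply: eq_bigr => j _; rewrite /bump add1n IHM; last by lia.
have leM : (j <= M)%N by rewrite -ltnS.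
have -> : (j.+1 + (M.+1 - j.+1)).-1 = M by lia.
have -> : (M.+1 - j.+1 = M - j)%N by lia.
have := qbin_sym q j (M - j); rewrite subnKC // => <-; rewrite addn1 mulnC /= add0n.
by ring.
Qed.

(** The factors of the i-th inner summand that depend on [la]; the remaining ones can be pulled out
    of the sum over partitions. *)
Definition col_weight n i la : F :=
  q ^- (2 * \sum_(1 <= k < i.+1) part_col n la k) * qint q (part_mult n la i).

(** Marking a part equal to i, proved by induction on i: stripping the first column k turns e_(i+1)
    into e_i and releases q^(-2k). Absorption then replaces [n; k] [k] by [n] [n-1; k-1], and
    [part_sum_rec] reassembles the sum. *)
Lemma fsum_col_weight i n M :
  \sum_(la \in partitions_of M n) part_weight n la * col_weight n i la
  = if (i <= M)%N then qint q n * q ^- (2 * i) * part_sum n.-1 (M - i) else 0.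
Proof.
elim: i n M => [|i IHi] n M; rewrite fsum_partitions_col.
  rewrite /= muln0 expr0 invr1 mulr1 subn0 part_sum_rec mulr_sumr big_mkcond.
  apply: eq_bigr => k _; case: ifPn => [le_n|]; last first.
    rewrite -ltnNge => lt_k; rewrite qbin_small ?mul0r ?mulr0 //.
    exact: leq_ltn_trans (leq_pred _) lt_k.
  (* For i = 0 the marked multiplicity is e_0 = n - k, hence the complementary absorption. *)
  rewrite !mulrA -qbin_absorb_compl // /part_sum mulr_fsumr.
  apply: eq_fsbigr => mu /set_mem[_ _ le_k].
  rewrite part_weight_add_col // /col_weight big_geq // muln0 expr0 invr1.
  by rewrite /part_mult part_col_add_col //; ring.
transitivity (\sum_(k < M.+1 | (k <= n)%N)
    qbin n k * q ^+ (k * k.-1) * q ^- (2 * k)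
    * \sum_(mu \in partitions_of (M - k) k) part_weight k mu * col_weight k i mu).
  apply: eq_bigr => k le_n; rewrite mulr_fsumr.
  apply: eq_fsbigr => mu /set_mem[_ _ le_k].
  rewrite part_weight_add_col // /col_weight part_mult_add_colS // big_add1 /=.
  rewrite big_ltn // part_col_add_col //= mulnDr exprD invfM.
  have -> : (\sum_(1 <= j < i.+1) part_col n (add_col k mu) j.+1
             = \sum_(1 <= j < i.+1) part_col k mu j)%N.
    by apply: eq_bigr => j _; rewrite part_col_add_col.
  by rewrite [part_col k mu 0]/part_col /=; ring.
transitivity (\sum_(k < M.+1) qbin n k * q ^+ (k * k.-1) * q ^- (2 * k)
    * (if (i <= M - k)%N
       then qint q k * q ^- (2 * i) * part_sum k.-1 (M - k - i) else 0)).
  rewrite big_mkcond; apply: eq_bigr => k _; rewrite IHi.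
  by case: ifPn => //; rewrite -ltnNge => /qbin_small ->; rewrite !mul0r.
rewrite big_ord_recl /= qint0 !mul0r if_same mulr0 add0r.
case: ifP => ltiM; last first.
  rewrite big1 // => k _; rewrite /bump add1n ifF ?mulr0 //.
  by have := ltn_ord k; lia.
have -> : (M - i.+1 = (M - i).-1)%N by lia.
have pos : (0 < M - i)%N by rewrite subn_gt0.
(* The recursion for P(n-1, M-i-1) has M - i terms; it is widened to M guarded terms to match the
   left-hand side. *)
rewrite part_sum_rec (prednK pos) 
  (big_ord_widen _ (fun k => qbin n.-1 k * q ^+ (k * k.-1)
     * part_sum k ((M - i).-1 - k)) (leq_subr i M)).
rewrite [in RHS]big_mkcond mulr_sumr; apply: eq_bigr => k _ /=.
rewrite /bump add1n.
have -> : (i <= M - k.+1)%N = (k < M - i)%N by have := ltn_ord k; lia.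
case: ifP => ltk; rewrite ?mulr0 //=.
have -> : ((M - i).-1 - k = M - k.+1 - i)%N by lia.
transitivity (qbin n k.+1 * qint q k.+1 * (q ^+ (k.+1 * k) * q ^- (2 * k.+1))
              * q ^- (2 * i) * part_sum k (M - k.+1 - i)); first by ring.
(* Thus k(k+1) - 2(k+1) = k(k-1) - 2: the exponent of the recursion, and a q^(-2) that turns q^(-2i)
   into q^(-2(i+1)). *)
have -> : (k.+1 * k = k * k.-1 + 2 * k)%N by case: (nat_of_ord k) => //= j; lia.
rewrite qbin_absorb // [(2 * k.+1)%N]mulnS [(2 * i.+1)%N]mulnS !exprD.
by field; apply/and3P; split=> //; apply: expf_neq0.
Qed.
End PartitionSums.

(** * Exchange of the two sums and the final convolution *)

Theorem theorem1p4 (F : fieldType) (q : F)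
    (q_neq0 : q != 0) (q_not_root1 : forall k : nat, (0 < k)%N -> q ^+ k != 1)
    (m n l p : nat) (m_ge1 : (1 <= m)%N) (n_ge1 : (1 <= n)%N) :
  \sum_(la \in partitions_of (m - 1) n)
     (q ^+ ((p + 1) * (m - 1) + 2 * part_n la)
      * qmultinomial q n (part_mults n la)
      * \sum_(i \in [set: nat]%classic)
          (q ^ ((1 - p%:Z) * i%:Z
                - 2 * (\sum_(1 <= k < i.+1) part_col n la k)%N%:Z)
           * qbinomial q (i%:Z + p%:Z - l%:Z) p%:Z
           * qint q (part_mult n la i)))
  = qint q n
    * qbinomial q (n%:Z + m%:Z - 2 + p%:Z - l%:Z) (n%:Z - 1 + p%:Z).
Proof.
case: m m_ge1 => // M _; case: n n_ge1 => // n _; rewrite subn1 /=.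
transitivity (\sum_(i < M.+1) q ^+ (p.+1 * M) * q ^ ((1 - p%:Z) * i%:Z)
    * qbinomial q (i%:Z + p%:Z - l%:Z) p%:Z
    * \sum_(la \in partitions_of M n.+1)
        part_weight q n.+1 la * col_weight q n.+1 i la).
  have fin := finite_partitions_of M n.+1.
  under [RHS]eq_bigr do rewrite mulr_fsumr (fsbig_finite _ _ fin).
  rewrite exchange_big /= -(fsbig_finite _ _ fin).
  apply: eq_fsbigr => la /set_mem[_ sum_la _].
  (* Only i <= M contributes, since e_i = 0 beyond the largest part, which is at most M. *)
  rewrite -(fsbig_widen `I_M.+1) //=; last first.
    move=> i [_ /negP]; rewrite -leqNgt -sum_la => lt_i.
    rewrite /= part_mult_large ?qint0 ?mulr0 //.
    exact: leq_ltn_trans (largest_part_le_sumn la) lt_i.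
  rewrite -fsbig_ord mulr_sumr; apply: eq_bigr => i _.
  rewrite /part_weight /col_weight expfzDr // addn1 exprD -(PoszM 2) -exprnN.
  by ring.
under eq_bigr => i _.
  rewrite fsum_col_weight // (ltn_ord i : (i <= M)%N) part_sumE //; over.
(* If M < l, every binomial involving l has its upper index, possibly negative, below its lower one,
   so both sides vanish. *)
have [ltMl|lelM] := ltnP M l.
  rewrite qbinomial_small ?mulr0; last by lia.
  rewrite big1 // => i _; rewrite qbinomial_small ?mulr0 ?mul0r //.
  by have := ltn_ord i; lia.
have -> : n.+1%:Z + M.+1%:Z - 2 + p%:Z - l%:Z = (n + p + (M - l))%N%:Z by lia.
have -> : n.+1%:Z - 1 + p%:Z = (n + p)%N%:Z by lia.
rewrite -qbin_conv // mulr_sumr.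
rewrite (big_ord_widen _ (fun j => qint q n.+1
  * (qbinomial q (M - l - j + p)%N%:Z p%:Z * q ^+ (p.+1 * j)
     * qbinomial q (n + j).-1%:Z j%:Z)) (leq_subr l M : (M - l < M.+1)%N)).
(* Reversal i -> M - i makes i the weight left after removing the marked part, the index j of
   [qbin_conv]. Terms with i > M - l vanish. *)
rewrite (reindex_inj rev_ord_inj) [RHS]big_mkcond; apply: eq_bigr => i _ /=.
have leiM : (i <= M)%N by rewrite -ltnS.
rewrite subSS subKn //; case: ifP => lti; last first.
  by rewrite qbinomial_small; [rewrite mulr0 mul0r | lia].
have -> : (M - i)%N%:Z + p%:Z - l%:Z = (M - l - i + p)%N%:Z by lia.
(* Since (1-p) - 2 = -(p+1), the exponents add up to (p+1)(M - (M-i)). *)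
have e_q : q ^+ (p.+1 * M) * q ^ ((1 - p%:Z) * (M - i)%N%:Z) * q ^- (2 * (M - i))
           = q ^+ (p.+1 * i).
  rewrite exprnN !exprnP -!expfzDr //; congr (q ^ _).
  by rewrite !PoszM -subzn // intS; ring.
rewrite -e_q; ring.
Qed.
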